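(* Consider the system $$\frac{d\theta[\boldsymbol\gamma]}{dt} = f(\theta[\boldsymbol\gamma],t) + B(t)\,\tilde u_a$$ for the turning angle $\theta[\boldsymbol\gamma]$ of the projected kite trajectory $\boldsymbol\gamma=\mathbf{r}/\|\mathbf{r}\|$, driven by the actuated control increments $\tilde u_a$, and the estimator update laws $$\frac{d\hat{\mathbf{w}}_i}{dt} := \Gamma\, e_m\,\lambda_i\,\tilde u_a\,\mathbf{b},\qquad i\in\{x,y,z\},\quad\Gamma>0.$$ Assume that there is a $t_0>0$ such that for all $t>t_0$ the conditions $$\|\dot{\boldsymbol\gamma}(t)\|>0\qquad\text{and}\qquad \left.\frac{d\ddot{\boldsymbol\gamma}}{du}\right|_t\not\parallel \mathbf{r}(t)$$ (the two vectors are not parallel) are satisfied. Then for any initial estimates, any reference trajectory and any actuated control increments $\tilde u_a$, the estimator errors $$\|\hat{\mathbf{w}}_i(t)-\mathbf{w}_i(t)\|,\qquad i\in\{x,y,z\},$$ are bounded, and the bound decreases in time for $t>t_0$.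
   Context: $\mathbf{r}(t)\in\mathbb{R}^3$ is the vector from the earth tether attachment point to the kite, $r=\|\mathbf{r}\|$, and $\boldsymbol\gamma=\mathbf{r}/r$ is its projection on the upper half of the unit sphere. For the point $(\cos\psi\cos\varphi,\cos\psi\sin\varphi,\sin\psi)$ of the sphere, the tangent plane has the orthonormal basis $\mathbf{e}_1=(-\sin\varphi,\cos\varphi,0)$, $\mathbf{e}_2=(-\cos\varphi\sin\psi,-\sin\varphi\sin\psi,\cos\psi)$. The turning angle $\theta[\boldsymbol\gamma]$ is the continuous (not restricted to $[-\pi,\pi]$) angle with $\dot{\boldsymbol\gamma}=\|\dot{\boldsymbol\gamma}\|(\cos\theta[\boldsymbol\gamma]\,\mathbf{e}_1+\sin\theta[\boldsymbol\gamma]\,\mathbf{e}_2)$, $\theta_t(t)$ is the target turning angle, and $e:=\theta[\boldsymbol\gamma]-\theta_t$. $u$ is the steering input and $u^*$ its current value; $\tilde u$ is the commanded increment of $u$, and $\tilde u_a$ the increment actually implemented by the actuator, which because of rate and magnitude constraints may differ from $\tilde u$. The acceleration $\ddot{\boldsymbol\gamma}$ is assumed locally affine in the increments. With $\dot x,\dot y,\ddot x,\ddot y$ the coordinates of velocity and acceleration of the projected trajectory in the basis $(\mathbf{e}_1,\mathbf{e}_2)$ and $\mathbf{e}_z$ the earth vertical unit vector, $$f=\left.\frac{d\theta[\boldsymbol\gamma]}{dt}\right|_{u^*}=\frac{\dot x\ddot y-\ddot x\dot y}{\|\dot{\boldsymbol\gamma}\|^2}-(\boldsymbol\gamma\cdot\mathbf{e}_z)\cos\theta[\boldsymbol\gamma]\,\|\dot{\boldsymbol\gamma}\|,\qquad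 B=\frac{\dot x\frac{\partial\ddot y}{\partial u}-\frac{\partial\ddot x}{\partial u}\dot y}{\|\dot{\boldsymbol\gamma}\|^2}.$$ All measured quantities enter through the time-dependence of $f$ and $B$. $B$ is linear in the control derivatives $C_{i,u}=\mathbf{w}_i\cdot\mathbf{b}$, $i\in\{x,y,z\}$ (dimensionless sensitivities of the aerodynamic force to $u$ in a body-fixed frame, functions of $u$, represented by B-spline networks): $B=\sum_i\lambda_i\,\mathbf{w}_i\cdot\mathbf{b}$ with coefficients $\lambda_i(t)\in\mathbb{R}$, vector $\mathbf{b}$ of B-spline basis functions, and true weights $\mathbf{w}_i$ (treated as constant in time). $\hat{\mathbf{w}}_i(t)$ is the estimate of $\mathbf{w}_i$. With gain $K>0$, the commanded increment and the modified tracking error are $$\tilde u := -\frac{1}{\sum_i \lambda_i \hat{\mathbf{w}}_i\cdot\mathbf{b}}\left[\left.\frac{d\theta[\boldsymbol\gamma]}{dt}\right|_{u^*} - \frac{d\theta_t}{dt} + K e\right],\qquad e_m:=e-\zeta,\qquad \frac{d\zeta}{dt}:=-K\zeta+\Big(\sum_i\lambda_i\hat{\mathbf{w}}_i\cdot\mathbf{b}\Big)(\tilde u_a-\tilde u).$$ ''The bound'' refers to the time-dependent bound $\sqrt{2\Gamma V_m(t)}$, where $V_m:=\frac12e_m^2+\frac12\Gamma^{-1}\sum_i\|\hat{\mathbf{w}}_i-\mathbf{w}_i\|^2$. *)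

(* Defs.v *)
From HB Require Import structures.
From mathcomp Require Import all_boot all_order all_algebra.
From mathcomp Require Import all_classical all_reals all_analysis.
Import Order.TTheory GRing.Theory Num.Theory.
Import numFieldNormedType.Exports.

Set Implicit Arguments.
Unset Strict Implicit.
Unset Printing Implicit Defensive.

Local Open Scope classical_set_scope.
Local Open Scope ring_scope.

Section Euclid.
Context {R : realType} {n : nat}.
Implicit Types u v : 'rV[R]_n.

Definition dot u v : R := \sum_(j < n) u 0 j * v 0 j.

(* The library norm `|u| on row vectors is the sup norm. *)
Definition enorm u : R := Num.sqrt (dot u u).

(* The zero vector is parallel to every vector. *)
Definition parallel u v : Prop :=
  exists a b : R, ((a != 0) || (b != 0)) /\ a *: u + b *: v = 0.

End Euclid.

Section Sphere.
Context {R : realType}.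

Definition vec3 (x y z : R) : 'rV[R]_3 := \row_(j < 3) [:: x; y; z]`_j.

Definition sph (phi psi : R) : 'rV[R]_3 :=
  vec3 (cos psi * cos phi) (cos psi * sin phi) (sin psi).

Definition e1 (phi : R) : 'rV[R]_3 := vec3 (- sin phi) (cos phi) 0.

Definition e2 (phi psi : R) : 'rV[R]_3 :=
  vec3 (- (cos phi * sin psi)) (- (sin phi * sin psi)) (cos psi).

Definition ez : 'rV[R]_3 := vec3 0 0 1.

Definition sphere_proj (r : R -> 'rV[R]_3) (t : R) : 'rV[R]_3 :=
  (enorm (r t))^-1 *: r t.

(* theta is a turning angle of gamma on the times t > t0; phi t, psi t are
   spherical coordinates of gamma t and fix the frame, also at the pole. *)
Definition turning_angle (t0 : R) (gamma : R -> 'rV[R]_3)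
    (phi psi theta : R -> R) : Prop :=
  (forall t, t0 < t -> {for t, continuous theta}) /\
  (forall t, t0 < t ->
     gamma^`()%classic t = enorm (gamma^`()%classic t) *:
       (cos (theta t) *: e1 (phi t) + sin (theta t) *: e2 (phi t) (psi t))).

End Sphere.

Section Kinematics.
Context {R : realType}.

(* acc t u is the acceleration of the projected trajectory at time t as a
   function of the value u of the steering input, and ustar t is the current
   value of that input. *)
Variables (gamma : R -> 'rV[R]_3) (phi psi : R -> R).
Variables (acc : R -> R -> 'rV[R]_3) (ustar : R -> R).

Definition acc_locally_affine (t : R) : Prop :=
  exists a : 'rV[R]_3, \forall v \near (0 : R),
    acc t (ustar t + v) = acc t (ustar t) + v *: a.

(* d gamma'' / du at time t *)
Definition acc_du (t : R) : 'rV[R]_3 := (acc t)^`()%classic (ustar t).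

Definition dx (t : R) : R := dot (gamma^`()%classic t) (e1 (phi t)).
Definition dy (t : R) : R := dot (gamma^`()%classic t) (e2 (phi t) (psi t)).
Definition ddx (t u : R) : R := dot (acc t u) (e1 (phi t)).
Definition ddy (t u : R) : R := dot (acc t u) (e2 (phi t) (psi t)).

(* acc is not required to reproduce the second derivative of gamma along the
   motion.  Differentiating the frame gives the exact rate of theta with
   gamma_z / sqrt (1 - gamma_z ^+ 2) in place of gamma_z in the last term, so
   identifying the two would make the system theta' = f + B ua unsolvable away
   from special directions; with acc free, f also covers the exact rate. *)
Definition turn_f (th t : R) : R :=
  (dx t * ddy t (ustar t) - ddx t (ustar t) * dy t)
  / enorm (gamma^`()%classic t) ^+ 2
  - dot (gamma t) ez * cos th * enorm (gamma^`()%classic t).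

Definition turn_B (t : R) : R :=
  (dx t * (ddy t)^`()%classic (ustar t) - (ddx t)^`()%classic (ustar t) * dy t)
  / enorm (gamma^`()%classic t) ^+ 2.

End Kinematics.

Section Splines.
Context {R : realType}.

(* Cox-de Boor recursion; x / 0 = 0 is the usual convention for repeated
   knots. *)
Fixpoint bspline (knots : nat -> R) (p j : nat) (u : R) : R :=
  if p is q.+1 then
    (u - knots j) / (knots (j + p)%N - knots j) * bspline knots q j u
    + (knots (j + p).+1 - u) / (knots (j + p).+1 - knots j.+1)
      * bspline knots q j.+1 u
  else ((knots j <= u) && (u < knots j.+1))%:R.

Definition bspline_basis (knots : nat -> R) (p n : nat) (u : R) : 'rV[R]_n :=
  \row_(j < n) bspline knots p j u.

End Splines.

Section Controller.
Context {R : realType} {n : nat}.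

(* The index type 'I_3 stands for the body axes x, y, z; b t is the vector of
   basis functions at the current input, and f t is the turning rate at zero
   increment. *)
Variables (K Gamma : R) (lam : 'I_3 -> R -> R) (b : R -> 'rV[R]_n).
Variables (w : 'I_3 -> 'rV[R]_n) (what : 'I_3 -> R -> 'rV[R]_n).
Variables (f theta theta_t zeta : R -> R).

Definition B_true (t : R) : R := \sum_(i < 3) lam i t * dot (w i) (b t).

Definition B_hat (t : R) : R := \sum_(i < 3) lam i t * dot (what i t) (b t).

Definition err (t : R) : R := theta t - theta_t t.

(* Meaningful only where B_hat t != 0. *)
Definition u_cmd (t : R) : R :=
  - (B_hat t)^-1 * (f t - theta_t^`()%classic t + K * err t).

Definition err_m (t : R) : R := err t - zeta t.

Definition V_m (t : R) : R :=
  2^-1 * err_m t ^+ 2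
  + 2^-1 * Gamma^-1 * \sum_(i < 3) enorm (what i t - w i) ^+ 2.

Definition est_bound (t : R) : R := Num.sqrt (2 * Gamma * V_m t).

End Controller.

(* Main.v *)
(** Differentiating the modified error and inserting the commanded increment
    cancels the turning rate and the reference, leaving
    [e_m' = - K e_m - (sum_i lam_i (what_i - w_i) . b) ua].  The update laws make
    the parameter part of [V_m'] cancel the last term against [e_m e_m'], so that
    [V_m' = - K e_m^2 <= 0] for [t > t0], while
    [||what_i - w_i||^2 <= 2 Gamma V_m].  On the remaining initial interval the
    estimates are bounded by continuity. *)
Require Import Defs.
From HB Require Import structures.
From mathcomp Require Import all_boot all_order all_algebra.
From mathcomp Require Import all_classical all_reals all_analysis.
From mathcomp Require Import ring.
Import Order.TTheory GRing.Theory Num.Theory.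
Import numFieldNormedType.Exports.

Local Open Scope classical_set_scope.
Local Open Scope ring_scope.

Section Dot.
Context {R : realType} {n : nat}.
Implicit Types (u v w : 'rV[R]_n) (f g : R -> 'rV[R]_n) (t : R).

Lemma dotC u v : dot u v = dot v u.
Proof. by apply: eq_bigr => j _; rewrite mulrC. Qed.

Lemma dotBl u v w : dot (u - v) w = dot u w - dot v w.
Proof. by rewrite /dot -sumrB; apply: eq_bigr => j _; rewrite !mxE mulrBl. Qed.

Lemma dotZr (a : R) u v : dot u (a *: v) = a * dot u v.
Proof. by rewrite /dot mulr_sumr; apply: eq_bigr => j _; rewrite mxE mulrCA. Qed.

Lemma dot_ge0 u : 0 <= dot u u.
Proof. by apply: sumr_ge0 => j _; rewrite -expr2 sqr_ge0. Qed.

Lemma sqr_enorm u : enorm u ^+ 2 = dot u u.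
Proof. by rewrite sqr_sqrtr ?dot_ge0. Qed.

Lemma continuous_enorm : continuous (@enorm R n).
Proof.
move=> u; apply: (@continuous_comp _ _ _ (fun u => dot u u)); last first.
  exact: sqrt_continuous.
apply: continuous_big; first exact: add_continuous.
by move=> j _ v; apply: continuousM; exact: coord_continuous.
Qed.

Lemma is_derive_coord f (df : 'rV[R]_n) (t : R) j :
  is_derive t 1 f df -> is_derive t 1 (fun s => f s 0 j) (df 0 j).
Proof.
move=> [fd <-]; rewrite (derive_mx fd) mxE.
by apply: derivableP; exact: (derivable_mxP f t 1).1.
Qed.

Lemma is_derive_dot f g (df dg : 'rV[R]_n) (t : R) :
  is_derive t 1 f df -> is_derive t 1 g dg ->
  is_derive t 1 (fun s => dot (f s) (g s)) (dot (f t) dg + dot df (g t)).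
Proof.
move=> fd gd; rewrite /dot -big_split /=.
(* The pointwise sum is recast as a sum of products of functions, the form on which the sum and
   product rules act. *)
rewrite (_ : (fun _ => _) =
  \sum_(j < n) ((f ^~ 0)^~ j * (g ^~ 0)^~ j)); last first.
  by apply/funext => s; rewrite fct_sumE.
apply: is_derive_sum => j.
have fj := is_derive_coord f df t j fd.
have gj := is_derive_coord g dg t j gd.
apply: (is_derive_eq (is_deriveM fj gj)).
by rewrite [df 0 j * _]mulrC.
Qed.

End Dot.

Section Lyapunov.
Context {R : realType} {n : nat}.
Variables (K Gamma : R) (lam : 'I_3 -> R -> R) (b : R -> 'rV[R]_n).
Variables (w : 'I_3 -> 'rV[R]_n) (what : 'I_3 -> R -> 'rV[R]_n).
Variables (f theta theta_t zeta ua : R -> R).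

Let Bhat := B_hat lam b what.
Let e_m := err_m theta theta_t zeta.
Let V := V_m Gamma w what theta theta_t zeta.

(** Since [Bhat t != 0], the product of [Bhat] and [u_cmd] is minus the bracket of the control law:
    [f] and the reference rate drop out, and [K * zeta] joins [- K * err] to form [- K * e_m]. *)
Lemma is_derive_err_m (t : R) : Bhat t != 0 ->
  is_derive t 1 theta (f t + B_true lam b w t * ua t) ->
  derivable theta_t t 1 ->
  is_derive t 1 zeta
    (- K * zeta t + Bhat t * (ua t - u_cmd K lam b what f theta theta_t t)) ->
  is_derive t 1 e_m (- K * e_m t - (Bhat t - B_true lam b w t) * ua t).
Proof.
move=> B0 thd /derivableP ttd zd.
have -> : e_m = theta - theta_t - zeta by [].
apply: is_derive_eq.
rewrite /u_cmd -/Bhat -derive1E /e_m /err_m /err !fctE; field.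
exact: B0.
Qed.

Lemma is_derive_V_m (t : R) : Gamma != 0 ->
  is_derive t 1 e_m (- K * e_m t - (Bhat t - B_true lam b w t) * ua t) ->
  (forall i,
    is_derive t 1 (what i) ((Gamma * e_m t * lam i t * ua t) *: b t)) ->
  is_derive t 1 V (- K * e_m t ^+ 2).
Proof.
move=> G0 ed wd.
pose c := 2^-1 * Gamma^-1.
pose S i s := dot (what i s - w i) (what i s - w i).
have Sd i : is_derive t 1 (S i)
    (2 * (Gamma * e_m t * ua t) * (lam i t * dot (what i t - w i) (b t))).
  have xd : is_derive t 1 (fun s => what i s - w i)
      ((Gamma * e_m t * lam i t * ua t) *: b t).
    by apply: is_derive_eq; rewrite subr0.
  apply: is_derive_eq; first exact: is_derive_dot.
  by rewrite [dot (_ *: _) _]dotC !dotZr; ring.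
have -> : V = 2^-1 \*: (e_m ^+ 2) + c \*: \sum_(i < 3) S i.
  apply/funext => s; rewrite /V /V_m !fctE fct_sumE.
  by congr (_ + _ * _); apply: eq_bigr => i _; rewrite sqr_enorm.
apply: is_derive_eq.
(* Both sums are linear in the weights with the same [lam] and [b], so their gap is the pairing that
   the update laws produce in [Sd]; the gain [Gamma] there cancels the [Gamma^-1] of [c]. *)
have -> : Bhat t - B_true lam b w t =
    \sum_(i < 3) lam i t * dot (what i t - w i) (b t).
  by rewrite -sumrB; apply: eq_bigr => i _; rewrite dotBl mulrBr.
rewrite -mulr_sumr /c /GRing.scale /= expr1; field.
exact: G0.
Qed.

(** Scaling [V] by [2 * Gamma] gives [Gamma * e_m ^+ 2] plus all squared errors, a sum of
    nonnegative terms that dominates each of them. *)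
Lemma enorm_le_est_bound i t : 0 < Gamma ->
  enorm (what i t - w i) <= est_bound Gamma w what theta theta_t zeta t.
Proof.
move=> G0; rewrite /est_bound {1}/enorm; apply: ler_wsqrtr.
rewrite -sqr_enorm (_ : 2 * Gamma * _ =
  Gamma * e_m t ^+ 2 + \sum_(k < 3) enorm (what k t - w k) ^+ 2); last first.
  by rewrite /V_m -/e_m; field; rewrite gt_eqF.
apply: ler_wpDl; first by rewrite mulr_ge0 ?sqr_ge0 ?ltW.
rewrite (bigD1 i)//= lerDl.
by apply: sumr_ge0 => k _; exact: sqr_ge0.
Qed.

End Lyapunov.

(** Serves the initial times, where only continuity of the estimates is available: a continuous
    function attains its maximum on a compact interval. *)
Lemma within_continuous_enorm_bounded {R : realType} {n : nat}
    (u : R -> 'rV[R]_n) (v : 'rV[R]_n) (T : R) :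
  {within `[0, +oo[, continuous u} -> 0 <= T ->
  exists M : R, forall t, 0 <= t <= T -> enorm (u t - v) <= M.
Proof.
move=> uc T0.
have cT : {within `[0, T], continuous (fun t => enorm (u t - v))}.
  have cu : {within `[0, T], continuous u}.
    exact/continuous_subspaceW/uc/subset_itvl.
  have cuv : {within `[0, T], continuous (fun t => u t - v)}.
    by move=> t; apply: continuousB; [exact: cu|exact: cst_continuous].
  by move=> t; apply: continuous_comp (cuv t) _; exact: continuous_enorm.
have [c _ cmax] := EVT_max T0 cT.
by exists (enorm (u c - v)) => t tT; apply: cmax; rewrite in_itv.
Qed.

Theorem theorem4p2 (R : realType) (t0 K Gamma : R)
  (* kite trajectory, spherical coordinates of its projection, turning angle *)
  (r : R -> 'rV[R]_3) (phi psi theta : R -> R)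
  (* acceleration as a function of time and input, current input *)
  (acc : R -> R -> 'rV[R]_3) (ustar : R -> R)
  (* B-spline networks *)
  (n p : nat) (knots : nat -> R) (lam : 'I_3 -> R -> R) (w : 'I_3 -> 'rV[R]_n)
  (* reference, actuated increments, estimates, error modification *)
  (theta_t ua : R -> R) (what : 'I_3 -> R -> 'rV[R]_n) (zeta : R -> R) :
  let gamma := sphere_proj r in
  let f := turn_f gamma phi psi acc ustar in
  let B := turn_B gamma phi psi acc ustar in
  let b := fun t => bspline_basis knots p n (ustar t) in
  let f_t := fun t => f (theta t) t in
  let Bhat := B_hat lam b what in
  let u_c := u_cmd K lam b what f_t theta theta_t in
  let e_m := err_m theta theta_t zeta in
  let bound := est_bound Gamma w what theta theta_t zeta in
  0 < t0 -> 0 < K -> 0 < Gamma ->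
  nondecreasing_seq knots ->
  (* projected trajectory and its turning angle *)
  (forall t, t0 < t -> r t != 0) ->
  (forall t, t0 < t -> derivable r t 1) ->
  (forall t, t0 < t -> 0 <= psi t <= pi / 2) ->
  (forall t, t0 < t -> gamma t = sph (phi t) (psi t)) ->
  turning_angle t0 gamma phi psi theta ->
  (* acceleration model and B-spline representation of B *)
  (forall t, t0 < t -> acc_locally_affine acc ustar t) ->
  (forall t, t0 < t -> B t = B_true lam b w t) ->
  (* conditions on the trajectory *)
  (forall t, t0 < t -> 0 < enorm (gamma^`()%classic t)) ->
  (forall t, t0 < t -> ~ parallel (acc_du acc ustar t) (r t)) ->
  (* the system *)
  (forall t, t0 < t -> is_derive t 1 theta (f (theta t) t + B t * ua t)) ->
  (* reference trajectory; the commanded increment is well defined *)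
  (forall t, t0 < t -> derivable theta_t t 1) ->
  (forall t, t0 < t -> Bhat t != 0) ->
  (* error modification and estimator update laws *)
  (forall t, t0 < t ->
     is_derive t 1 zeta (- K * zeta t + Bhat t * (ua t - u_c t))) ->
  (forall i, {within `[0, +oo[, continuous (what i)}) ->
  (forall i t, t0 < t ->
     is_derive t 1 (what i) ((Gamma * e_m t * lam i t * ua t) *: b t)) ->
  (* the estimator errors are bounded, by a bound that decreases for t > t0 *)
  (exists M : R, forall i t, 0 <= t -> enorm (what i t - w i) <= M) /\
  (forall i t, t0 < t -> enorm (what i t - w i) <= bound t) /\
  {in `]t0, +oo[ &, nonincreasing_fun bound}.
Proof.
move=> gamma f B b f_t Bhat u_c e_m bound t0_gt0 K0 G0 _ _ _ _ _ _ _ BE _ _.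
move=> thd ttd B0 zd wc wd.
pose V := V_m Gamma w what theta theta_t zeta.
have thBd t : t0 < t -> is_derive t 1 theta (f_t t + B_true lam b w t * ua t).
  by move=> tt; rewrite -BE//; exact: thd.
clear BE thd; clearbody f_t b.
have Vd t : t0 < t -> is_derive t 1 V (- K * e_m t ^+ 2).
  move=> tt; apply: (is_derive_V_m K Gamma lam b w what theta theta_t zeta ua).
  - by rewrite gt_eqF.
  - exact: is_derive_err_m (B0 t tt) (thBd t tt) (ttd t tt) (zd t tt).
  - by move=> i; exact: wd.
(* The half-line starts at [x > t0] because differentiability, hence continuity at the closed
   endpoint, is given only after [t0]. *)
have Vle x y : t0 < x -> x <= y -> V y <= V x.
  move=> tx; apply: (@ler0_derive1_nincry _ V x) => //.
  - by move=> s; rewrite in_itv/= andbT => xs; have [] := Vd s (lt_trans tx xs).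
  - move=> s; rewrite in_itv/= andbT => xs; rewrite derive1E.
    have [_ ->] := Vd s (lt_trans tx xs).
    by rewrite mulNr oppr_le0 mulr_ge0 ?sqr_ge0// ltW.
  - apply: continuous_in_subspaceT => s; rewrite inE/= in_itv/= andbT => xs.
    apply: differentiable_continuous; apply/derivable1_diffP.
    by have [] := Vd s (lt_le_trans tx xs).
have bound_le x y : t0 < x -> x <= y -> bound y <= bound x.
  by move=> tx xy; apply: ler_wsqrtr; rewrite ler_wpM2l ?Vle// mulr_ge0// ltW.
have wle i t : enorm (what i t - w i) <= bound t.
  exact: enorm_le_est_bound.
(* Monotonicity of [bound] holds strictly after [t0], so time is split at a point beyond [t0]. *)
have t01 : t0 < t0 + 1 by rewrite ltrDl.
split; last split => //; last first.
  by move=> x y; rewrite !in_itv/= !andbT => tx _; exact: bound_le.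
have T0 : 0 <= t0 + 1 by rewrite addr_ge0 ?ltW.
have /choice[M MP] i := within_continuous_enorm_bounded (what i) (w i) _ (wc i) T0.
(* The first term serves late times, the sum early ones; absolute values make the sum dominate every
   [M i], whose sign is not known. *)
exists (bound (t0 + 1) + \sum_i `|M i|) => i t t_ge0.
have [tT|/ltW tT] := leP t (t0 + 1).
  apply: ler_wpDl; first exact: sqrtr_ge0.
  apply: (le_trans (MP i t _)); first by rewrite t_ge0.
  by rewrite (bigD1 i)//= ler_wpDr ?ler_norm ?sumr_ge0.
apply: ler_wpDr; first exact: sumr_ge0.
apply: le_trans (bound_le _ _ t01 tT).
exact: wle.
Qed.
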